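(* Let $b\ge3$ be odd, $n$ an even positive integer, and $K$ the transition matrix of the balanced carries chain on $\{-\tfrac n2,\dots,\tfrac n2\}$. For $0\le j\le n$ and $-\tfrac n2\le i\le\tfrac n2$ let $u_j^n[i]$ be the coefficient of $x^{n-j}$ in the polynomial \[ (x-n-2i+1)(x-n-2i+3)\cdots(x-n-2i+2n-1). \] Then for each $0\le j\le n$, $u_j^n$ is a right eigenvector of $K$ with eigenvalue $1/b^j$, i.e. $\sum_{k=-n/2}^{n/2}K(i,k)\,u_j^n[k]=b^{-j}u_j^n[i]$ for all $-\tfrac n2\le i\le\tfrac n2$.
   Context: Balanced digits base $b$ ($b$ odd) are the integers $-\tfrac{b-1}{2},\dots,\tfrac{b-1}{2}$. When $n$ numbers in balanced digits are added column by column from right to left, if the carry into a column is $i$ and the column digits are $X_1,\dots,X_n$, the carry out is the unique integer $j$ with $jb-\tfrac{b-1}{2}\le i+X_1+\cdots+X_n\le jb+\tfrac{b-1}{2}$; the first carry is $0$. With all digits independent and uniform, the carries form a Markov chain (the balanced carries chain) with state space $\{-\tfrac n2,\dots,\tfrac n2\}$ for $n$ even; $K(i,j)$ is the probability the carry out is $j$ given carry in $i$. *)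

(* Defs.v *)
From HB Require Import structures.
From mathcomp Require Import all_boot all_order all_algebra.
From mathcomp Require Import zify.

Set Implicit Arguments.
Unset Strict Implicit.
Unset Printing Implicit Defensive.

Import Order.TTheory GRing.Theory Num.Theory.
Local Open Scope ring_scope.

(* For odd b, the digits range over -(b-1)/2, ..., (b-1)/2. *)
Definition balanced_digit (b : nat) (d : 'I_b) : int :=
  (val d)%:Z - (b.-1)./2%:Z.

(* The total t of a column (carry in plus digits) produces the carry out j. *)
Definition is_carry_out (b : nat) (t j : int) : bool :=
  j * b%:Z - (b.-1)./2%:Z <= t <= j * b%:Z + (b.-1)./2%:Z.

(* For even n, the states are -n/2, ..., n/2. *)
Definition carry_state (n : nat) (s : 'I_n.+1) : int :=
  (val s)%:Z - n./2%:Z.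

Definition column_total (b n : nat) (i : int) (X : {ffun 'I_n -> 'I_b}) : int :=
  i + \sum_(k < n) balanced_digit (X k).

(* Independent uniform digits: X is uniform on the b ^ n possible columns. *)
Definition balanced_carries (R : realFieldType) (b n : nat) : 'M[R]_n.+1 :=
  \matrix_(i, j)
    (#|[set X : {ffun 'I_n -> 'I_b}
        | is_carry_out b (column_total (carry_state i) X) (carry_state j)]|%:R
     / #|{ffun 'I_n -> 'I_b}|%:R).

(* (x - n - 2i + 1)(x - n - 2i + 3) ... (x - n - 2i + 2n - 1) *)
Definition carry_poly (R : realFieldType) (n : nat) (i : int) : {poly R} :=
  \prod_(m < n) ('X + (- n%:Z - 2 * i + (2 * m + 1)%N%:Z)%:~R%:P).

Definition carry_vector (R : realFieldType) (n j : nat) : 'cV[R]_n.+1 :=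
  \col_i (carry_poly R n (carry_state i))`_(n - j).

(* mxalgebra's eigenvalue/eigenspace concern row vectors, v *m A = a *: v. *)
Definition right_eigenvector (R : realFieldType) (m : nat)
    (A : 'M[R]_m) (a : R) (v : 'cV[R]_m) : Prop :=
  v != 0 /\ A *m v = a *: v.

Lemma carry_out_exists_unique (b : nat) (t : int) :
  odd b -> exists! j : int, is_carry_out b t j.
Proof.
move=> hb; have [q hq] : exists q, b = (2 * q + 1)%N by exists b./2; lia.
rewrite /is_carry_out; have -> : (b.-1)./2 = q by lia.
rewrite hq; exists (divz (t + q%:Z) (2 * q + 1)%N%:Z).
have := divz_eq (t + q%:Z) (2 * q + 1)%N%:Z.
have := @ltz_pmod (t + q%:Z) (2 * q + 1)%N%:Z.
have := @modz_ge0 (t + q%:Z) (2 * q + 1)%N%:Z.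
set r := modz _ _; set d := divz _ _ => h0 h1 h2.
by split=> [|j hj]; nia.
Qed.

Lemma carry_out_state (b n : nat) (i : 'I_n.+1) (X : {ffun 'I_n -> 'I_b})
    (j : int) :
  odd b -> ~~ odd n -> is_carry_out b (column_total (carry_state i) X) j ->
  exists s : 'I_n.+1, j = carry_state s.
Proof.
move=> hb hn; rewrite /is_carry_out /column_total /carry_state.
have [q hq] : exists q, b = (2 * q + 1)%N by exists b./2; lia.
have [p hp] : exists p, n = (2 * p)%N by exists n./2; lia.
have eq1 : (b.-1)./2 = q by lia.
have eq2 : n./2 = p by lia.
have hS : - (n%:Z * q%:Z) <= \sum_(k < n) balanced_digit (X k) <= n%:Z * q%:Z.
  have nE : n%:Z * q%:Z = \sum_(k < n) q%:Z.
    by rewrite sumr_const card_ord -mulr_natl natz.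
  rewrite nE -sumrN; apply/andP; split; apply: ler_sum => k _;
    rewrite /balanced_digit eq1; have := ltn_ord (X k); rewrite [X in (_ < X)%N]hq /=; lia.
move: hS; set S := \sum_(_ < _) _ => hS.
have hi := ltn_ord i.
rewrite eq1 eq2 => hj.
have [h1 h2] : - p%:Z <= j /\ j <= p%:Z.
  move: hS hj hi; rewrite /=; move: (nat_of_ord i) => v.
  by clearbody S; move: S; rewrite hq hp => S hS hj hi; split; nia.
have hs : (`|(j + p%:Z)%R|%N < n.+1)%N by lia.
by exists (Ordinal hs) => /=; lia.
Qed.

(* Main.v *)
(** The vectors [carry_vector R n j] are the coefficient vectors of the
    polynomials [f_i = carry_poly R n i], so the eigenvector equations for all
    [j] together say that the mean of [f_k] over the carry-out [k] is
    [f_i(b x) / b^n].  At [x = 2 z + n + 1] one has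
    [f_k(x) = 2^n n! C(z - k + n, n)], and [C(m + n, n)] counts the [n]-tuples
    of naturals with sum at most [m].  The identity follows by writing each
    entry of such a tuple as [d + b c] with [0 <= d < b]: for fixed remainders
    [d] the sum of the quotients [c] is bounded by [z - k], where [k] is the
    carry out of the column with digits [d].  Finally, the [i]-th entry of the
    vector is a polynomial of degree exactly [j <= n] in [i], so it cannot
    vanish at all [n + 1] states. *)
Require Import Defs.
From mathcomp Require Import all_boot all_order all_algebra.
From mathcomp Require Import zify ring.
Import Order.TTheory GRing.Theory Num.Theory.
Local Open Scope ring_scope.

(** * Counting tuples of bounded sum *)

(* The number of n-tuples of naturals with sum at most M, for M in int. *)
Definition bounded_sums (n : nat) (M : int) : nat :=
  if M is Posz m then 'C(m + n, n) else 0%N.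

Lemma bounded_sums0 (M : int) : bounded_sums 0 M = (0 <= M) :> nat.
Proof. by case: M => m //=; rewrite bin0. Qed.

Lemma bounded_sums_lt0 (n : nat) (M : int) : M < 0 -> bounded_sums n M = 0%N.
Proof. by case: M. Qed.

Lemma bounded_sumsS (n : nat) (M : int) :
  bounded_sums n.+1 M = (bounded_sums n M + bounded_sums n.+1 (M - 1))%N.
Proof.
case: M => [[|m]|m].
- by rewrite /= !add0n !binn.
- have -> : m.+1%:Z - 1 = m by lia.
  by rewrite /= addnS binS -addSnnS addnC.
- by rewrite !bounded_sums_lt0 //; lia.
Qed.

(** Classify tuples by one entry [v]. The proof iterates Pascal's rule [B] times; the leftover term
    has the negative argument [M - B] and vanishes. *)
Lemma sum_bounded_sums (n B : nat) (M : int) : M < B%:Z ->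
  (\sum_(v < B) bounded_sums n (M - v%:Z))%N = bounded_sums n.+1 M.
Proof.
move=> ltMB.
suff -> : bounded_sums n.+1 M =
    (\sum_(v < B) bounded_sums n (M - v%:Z) + bounded_sums n.+1 (M - B%:Z))%N.
  by rewrite [X in (_ + X)%N]bounded_sums_lt0 ?addn0 // subr_lt0.
elim: B {ltMB} => [|B IH]; first by rewrite big_ord0 add0n subr0.
rewrite big_ord_recr /= IH (bounded_sumsS n (M - B%:Z)) addnA.
by congr (_ + bounded_sums _ _)%N; lia.
Qed.

Definition ffun_cons (T : finType) (n : nat) (p : T * {ffun 'I_n -> T}) :
  {ffun 'I_n.+1 -> T} := [ffun k => oapp p.2 p.1 (unlift ord0 k)].

Lemma ffun_cons_bij (T : finType) (n : nat) : bijective (@ffun_cons T n).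
Proof.
exists (fun f : {ffun 'I_n.+1 -> T} => (f ord0, [ffun k => f (lift ord0 k)])).
  move=> [d D]; congr (_, _); first by rewrite ffunE unlift_none.
  by apply/ffunP=> k; rewrite !ffunE liftK.
move=> f; apply/ffunP=> k; rewrite ffunE.
by case: unliftP => [k' ->|->] /=; rewrite ?ffunE.
Qed.

Lemma big_ffunS (V : nmodType) (T : finType) (n : nat)
    (F : {ffun 'I_n.+1 -> T} -> V) :
  \sum_D F D =
  \sum_(d : T) \sum_(D : {ffun 'I_n -> T}) F (ffun_cons T n (d, D)).
Proof.
rewrite pair_big /= (reindex (ffun_cons T n)); last first.
  exact: onW_bij (ffun_cons_bij T n).
by apply: eq_bigr => -[d D].
Qed.

Lemma sum_ffun_cons (b n : nat) (d : 'I_b) (D : {ffun 'I_n -> 'I_b}) :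
  \sum_k (ffun_cons _ n (d, D) k)%:Z = d%:Z + \sum_k (D k)%:Z.
Proof.
rewrite big_ord_recl ffunE unlift_none /=; congr (_ + _).
by apply: eq_bigr => k _; rewrite ffunE liftK.
Qed.

Lemma sum_nat_divmod (b B : nat) (F : nat -> nat) :
  (\sum_(v < B * b) F v = \sum_(d < b) \sum_(c < B) F (d + b * c))%N.
Proof.
rewrite exchange_big /=; elim: B => [|B IH]; first by rewrite mul0n !big_ord0.
rewrite big_ord_recr /= -IH mulSnr big_split_ord /=; congr (_ + _)%N.
by apply: eq_bigr => d _; rewrite addnC mulnC.
Qed.

Lemma sum_bounded_sums_divz (b n : nat) (M : int) : (0 < b)%N ->
  (\sum_(D : {ffun 'I_n -> 'I_b})
     bounded_sums n ((M - \sum_k (D k)%:Z) %/ b%:Z)%Z)%N = bounded_sums n M.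
Proof.
move=> b_gt0; elim: n M => [|n IH] M.
  rewrite (big_pred1 [ffun k => Ordinal b_gt0]); last first.
    by move=> D; apply/esym/eqP/ffunP => -[].
  by rewrite big_ord0 subr0 !bounded_sums0 divz_ge0.
(* [B] truncates the quotients and [B * b] the entries; both exceed [M], so the truncated terms are
   all zero. *)
have [B ltMB] : exists B : nat, M < B%:Z by exists `|M|.+1%N; lia.
have ltMBb : M < B%:Z * b%:Z.
  by apply: lt_le_trans ltMB _; rewrite -PoszM lez_nat leq_pmulr.
rewrite (big_ffunS nat).
transitivity (\sum_(d < b) \sum_(c < B)
    bounded_sums n (M - (d + b * c)%N%:Z))%N; last first.
  rewrite -(sum_nat_divmod b B (fun v => bounded_sums n (M - v%:Z))).
  by rewrite sum_bounded_sums // PoszM.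
apply: eq_bigr => d _.
transitivity (\sum_(D : {ffun 'I_n -> 'I_b}) \sum_(c < B)
    bounded_sums n ((M - (d + b * c)%N%:Z - \sum_k (D k)%:Z) %/ b%:Z)%Z)%N.
  apply: eq_bigr => D _; rewrite sum_ffun_cons.
  have S_ge0 : 0 <= \sum_k (D k)%:Z by apply: sumr_ge0.
  rewrite -(@sum_bounded_sums n B).
    apply: eq_bigr => c _; congr bounded_sums.
    rewrite [in RHS](_ : M - (d + b * c)%N%:Z - _ =
      (- c%:Z) * b%:Z + (M - (d%:Z + \sum_k (D k)%:Z)));
      last by rewrite PoszD PoszM; ring.
    by rewrite divzMDl // ?eqz_nat -?lt0n // addrC.
  rewrite ltz_divLR ?ltz_nat //; apply: le_lt_trans ltMBb.
  by rewrite lerBlDr lerDl addr_ge0.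
by rewrite exchange_big; apply: eq_bigr => c _; exact: IH.
Qed.

(** * Carries and values of the carry polynomials *)

Definition carry_out (b : nat) (t : int) : int :=
  ((t + (b.-1)./2%:Z) %/ b%:Z)%Z.

Lemma is_carry_outE (b : nat) (t j : int) :
  odd b -> is_carry_out b t j = (j == carry_out b t).
Proof.
move=> b_odd; rewrite /carry_out /is_carry_out.
have b_gt0 : 0 < b%:Z by lia.
set q := (b.-1)./2; have bE : b%:Z = 2 * q%:Z + 1 by lia.
apply/idP/eqP => [h|->].
  have -> : t + q%:Z = j * b%:Z + (t + q%:Z - j * b%:Z) by ring.
  by rewrite divzMDl ?lt0r_neq0 // divz_small ?addr0 //; lia.
have := divz_eq (t + q%:Z) b%:Z.
have := modz_ge0 (t + q%:Z) (lt0r_neq0 b_gt0).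
have := ltz_pmod (t + q%:Z) b_gt0.
set r := modz _ _; set d := divz _ _; move: (d * b%:Z) => db; lia.
Qed.

(** With [k] the carry out of [t], the remainder [t - k * b] lies within [(b-1)/2] of 0, so
    subtracting it from [(b-1)/2] gives a number in [[0, b-1]]. *)
Lemma divz_carry_out (b : nat) (z t : int) : odd b ->
  ((b%:Z * z + (b.-1)./2%:Z - t) %/ b%:Z)%Z = z - carry_out b t.
Proof.
move=> b_odd; have b_neq0 : b%:Z != 0 by lia.
have : is_carry_out b t (carry_out b t) by rewrite is_carry_outE.
rewrite /is_carry_out; move: (carry_out b t) => k hk.
have -> : b%:Z * z + (b.-1)./2%:Z - t =
    (z - k) * b%:Z + (k * b%:Z + (b.-1)./2%:Z - t) by ring.
by rewrite divzMDl // divz_small ?addr0 //; lia.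
Qed.

Lemma horner_carry_poly (R : realFieldType) (n N : nat) (k : int) :
  (carry_poly R n k).[(2 * N%:Z + 2 * k + n%:Z + 1)%:~R] =
  (2 ^ n * n`! * bounded_sums n N)%:R.
Proof.
rewrite /carry_poly horner_prod /= -mulnA [(n`! * _)%N]mulnC bin_ffact.
rewrite ffact_prod -[X in (X ^ n)%N]/2%N -[X in (2 ^ X * _)%N]card_ord.
rewrite -prod_nat_const -big_split natr_prod /=.
(* The factors on the left are [2 * (N + m + 1)], increasing in [m], while the falling factorial
   lists them in decreasing order. *)
rewrite [RHS](reindex_inj rev_ord_inj); apply: eq_bigr => m _ /=.
rewrite hornerD hornerX hornerC -intrD [RHS]pmulrn; congr (_%:~R).
by have := ltn_ord m; lia.
Qed.

Lemma poly_eq_many (R : realFieldType) (p q : {poly R}) (x : nat -> R) :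
  injective x -> (forall y, p.[x y] = q.[x y]) -> p = q.
Proof.
move=> x_inj eq_pq; apply/eqP; rewrite -subr_eq0; apply/negPn/negP => nz.
have := max_poly_roots nz (rs := [seq x y | y <- iota 0 (size (p - q))]).
rewrite map_inj_uniq // iota_uniq size_map size_iota ltnn => H.
suff: false by []; apply: H => //; apply/allP => _ /mapP [y _ ->].
by rewrite /root hornerD hornerN eq_pq subrr.
Qed.

Lemma sum_carry_poly (R : realFieldType) (b n : nat) (s : 'I_n.+1) :
  odd b -> ~~ odd n ->
  \sum_(X : {ffun 'I_n -> 'I_b})
     carry_poly R n (carry_out b (column_total (carry_state s) X)) =
  carry_poly R n (carry_state s) \Po (b%:R *: 'X).
Proof.
move=> b_odd n_even; set i := carry_state s; set q := (b.-1)./2.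
have bE : b%:Z = 2 * q%:Z + 1 by lia.
have i_le : i <= n%:Z by have := ltn_ord s; rewrite /i /carry_state /=; lia.
(* Sampling only at [z = n + y >= n] keeps [z - k] nonnegative for every carry [k], as
   [horner_carry_poly] requires. *)
apply: (@poly_eq_many _ _ _ (fun y => (2 * (n + y)%N%:Z + n%:Z + 1)%:~R)).
  by move=> y1 y2 /intr_inj; lia.
move=> y; set z := (n + y)%N%:Z.
(* [M] solves [b * (2z + n + 1) = 2M + 2i + n + 1] with [b = 2q + 1]. Of its [n + 1] copies of [q],
   [n] center the digits and one does the rounding in [carry_out]. *)
have [M ME] : exists M : nat, M%:Z = b%:Z * z - i + q%:Z * (n%:Z + 1).
  exists `|(b%:Z * z - i + q%:Z * (n%:Z + 1))%R|%N; rewrite gez0_abs //.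
  rewrite addr_ge0 ?mulr_ge0 // subr_ge0 (le_trans i_le) // -PoszM lez_nat.
  by rewrite (leq_trans (leq_addr y n)) // leq_pmull ?odd_gt0.
rewrite horner_sum horner_comp hornerZ hornerX [b%:R]pmulrn -intrM.
have -> : b%:Z * (2 * z + n%:Z + 1) = 2 * M%:Z + 2 * i + n%:Z + 1.
  by rewrite ME bE; ring.
rewrite horner_carry_poly -(@sum_bounded_sums_divz b) ?odd_gt0 //.
rewrite big_distrr natr_sum; apply: eq_bigr => X _ /=.
set k := carry_out _ _.
have [s' kE] : exists s' : 'I_n.+1, k = carry_state s'.
  by apply: (@carry_out_state b n s X k) => //; rewrite is_carry_outE.
have k_le : k <= z by have := ltn_ord s'; rewrite kE /carry_state /=; lia.
have [N NE] : exists N : nat, N%:Z = z - k by exists `|(z - k)%R|%N; lia.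
have -> : 2 * z + n%:Z + 1 = 2 * N%:Z + 2 * k + n%:Z + 1 by rewrite NE; ring.
rewrite horner_carry_poly NE /k -divz_carry_out //.
congr (_ * bounded_sums _ (_ %/ _)%Z)%:R; rewrite ME /column_total -/i.
rewrite /balanced_digit sumrB sumr_const card_ord -/q -mulr_natr /=; ring.
Qed.

(** * The vectors are nonzero *)

(** Taylor expansion at [c]; it turns the entries of [carry_vector] into values of a single
    polynomial at the points [-2i]. *)
Lemma coef_comp_XaddC (R : comNzRingType) (p : {poly R}) (c : R) (k : nat) :
  (p \Po ('X + c%:P))`_k = p^`N(k).[c].
Proof.
rewrite /comp_poly addrC nderiv_taylor; last exact: mulrC.
rewrite size_map_polyC coef_sum.
under eq_bigr => i _ do rewrite nderivn_map horner_map /= coefCM coefXn.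
have [ltkp|lepk] := ltnP k (size p).
  rewrite (bigD1 (Ordinal ltkp)) //= eqxx mulr1 big1 ?addr0 // => i neik.
  rewrite [k == i]eq_sym -[i == k :> nat]/(i == Ordinal ltkp).
  by rewrite (negPf neik) mulr0.
rewrite big1 => [|i _]; last by rewrite gtn_eqF ?mulr0 // (leq_trans _ lepk).
by rewrite nderivn_poly0 ?horner0.
Qed.

Lemma carry_poly_shift (R : realFieldType) (n : nat) (i : int) :
  carry_poly R n i = carry_poly R n 0 \Po ('X + (- (2 * i)%:~R)%:P).
Proof.
rewrite /carry_poly rmorph_prod /=; apply: eq_bigr => m _.
rewrite comp_polyD comp_polyX comp_polyC -[RHS]addrA -polyCD -mulrNz -intrD.
by congr (_ + (_%:~R)%:P); ring.
Qed.

Lemma carry_poly0_monic (R : realFieldType) (n : nat) :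
  carry_poly R n 0 \is monic.
Proof. by apply: monic_prod => m _; rewrite monicXaddC. Qed.

Lemma size_carry_poly0 (R : realFieldType) (n : nat) :
  size (carry_poly R n 0) = n.+1.
Proof.
rewrite /carry_poly size_prod => [|m _]; last first.
  by rewrite -size_poly_gt0 size_XaddC.
under eq_bigr => m _ do rewrite size_XaddC.
by rewrite sum_nat_const card_ord; lia.
Qed.

Lemma carry_vector_neq0 (R : realFieldType) (n j : nat) :
  (j <= n)%N -> carry_vector R n j != 0.
Proof.
move=> lejn; apply/eqP => v0; set p := (carry_poly R n 0)^`N(n - j).
have p_nz : p != 0.
  (* The coefficient of [x^j] is [C(n, n - j)], nonzero in characteristic 0. *)
  apply/eqP => /(congr1 (fun r : {poly R} => r`_j)).
  rewrite coef_nderivn coef0 subnK //.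
  have := carry_poly0_monic R n; rewrite monicE lead_coefE size_carry_poly0.
  move=> /eqP -> /eqP; rewrite pnatr_eq0 -leqn0 leqNgt bin_gt0.
  by rewrite leq_subr.
have size_p : (size p <= j.+1)%N.
  apply/leq_sizeP => m ltjm; rewrite coef_nderivn nth_default ?mul0rn //.
  by rewrite size_carry_poly0; lia.
have := max_poly_roots p_nz
  (rs := [seq (- (2 * carry_state s)%:~R) : R | s <- enum 'I_n.+1]).
rewrite size_map size_enum_ord map_inj_uniq ?enum_uniq; last first.
  move=> s1 s2 /oppr_inj /intr_inj; rewrite /carry_state /= => h.
  by apply: val_inj => /=; lia.
move=> H; suff: (n.+1 < size p)%N by lia.
apply: H => //; apply/allP => _ /mapP [s _ ->]; apply/rootP.
rewrite -coef_comp_XaddC -carry_poly_shift.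
by move/colP: v0 => /(_ s); rewrite !mxE.
Qed.

(** * The eigenvector equation *)

(** Each column has exactly one carry out, and it is a state, so columns can be grouped by it.
    Values in a module allow [F] to be polynomial-valued, which treats all [j] at once. *)
Lemma sum_balanced_carries (R : realFieldType) (b n : nat) (s : 'I_n.+1)
    (V : lmodType R) (F : int -> V) : odd b -> ~~ odd n ->
  \sum_k balanced_carries R b n s k *: F (carry_state k) =
  (b%:R ^+ n)^-1 *: \sum_(X : {ffun 'I_n -> 'I_b})
     F (carry_out b (column_total (carry_state s) X)).
Proof.
move=> b_odd n_even; rewrite scaler_sumr.
transitivity (\sum_(k < n.+1) \sum_(X : {ffun 'I_n -> 'I_b} |
    is_carry_out b (column_total (carry_state s) X) (carry_state k))
  ((b%:R ^+ n)^-1 *: F (carry_state k))).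
  apply: eq_bigr => k _; rewrite mxE card_ffun !card_ord natrX sumr_const.
  by rewrite -scaler_nat scalerA cardsE.
rewrite (exchange_big_dep xpredT) //=; apply: eq_bigr => X _.
have [k kE] := @carry_out_state b n s X _ b_odd n_even
  (etrans (is_carry_outE _ _ _ b_odd) (eqxx _)).
rewrite kE (big_pred1 k) // => k'.
rewrite is_carry_outE // kE /carry_state /=.
by apply/eqP/eqP => [h|->] //; apply: val_inj => /=; lia.
Qed.

Lemma coef_comp_scaleX (R : comNzRingType) (p : {poly R}) (c : R) (k : nat) :
  (p \Po (c *: 'X))`_k = c ^+ k * p`_k.
Proof.
rewrite coef_comp_poly.
under eq_bigr => i _ do rewrite exprZn coefZ coefXn mulrCA.
have [ltkp|lepk] := ltnP k (size p).
  rewrite (bigD1 (Ordinal ltkp)) //= eqxx mulr1 big1 ?addr0 // => i neik.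
  rewrite [k == i]eq_sym -[i == k :> nat]/(i == Ordinal ltkp).
  by rewrite (negPf neik) !mulr0.
rewrite nth_default // mulr0 big1 // => i _.
by rewrite gtn_eqF ?mulr0 // (leq_trans _ lepk).
Qed.

Theorem theorem4p1 (R : realFieldType) (b n j : nat)
  (hb3 : (3 <= b)%N) (hb : odd b) (hn0 : (0 < n)%N) (hn : ~~ odd n)
  (hj : (j <= n)%N) :
  right_eigenvector (balanced_carries R b n) (1 / b%:R ^+ j)
    (carry_vector R n j).
Proof.
split; first exact: carry_vector_neq0.
have b_nz : b%:R != 0 :> R by rewrite pnatr_eq0 -lt0n odd_gt0.
apply/colP => s; rewrite !mxE.
transitivity (\sum_k balanced_carries R b n s k *:
    carry_poly R n (carry_state k))`_(n - j).
  rewrite coef_sum; apply: eq_bigr => k _.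
  by rewrite coefZ [carry_vector _ _ _ _ _]mxE.
rewrite sum_balanced_carries // sum_carry_poly // coefZ.
rewrite coef_comp_scaleX mulrA; congr (_ * _).
(* Substituting [b x] gave the factor [b^(n-j)], which cancels against [b^(-n)] to leave
   [b^(-j)]. *)
by rewrite -{1}(subnK hj) exprD invfM mulrAC mulVf ?mul1r ?div1r ?expf_neq0.
Qed.
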